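(* Let $n = 2^l \cdot m$, where $l \geq 0$ is an integer and $m$ is a positive odd integer, and let $q = 2^n$. Let $C_{q^2+1}$ be the cyclic subgroup of order $q^2+1$ of $\mathbb{F}_{q^4}^*$ and let $H := C_{q^2+1} \setminus \{1\}$. Define three subsets $H_1, H_2, H_3$ of $H$ as follows. (1) $\gamma \in H$ belongs to $H_1$ if and only if $|\theta(\gamma)|$ divides $q+1$ and $|\theta^i(\gamma)|$ divides $q-1$ for all integers $i \geq 2$. (2) $\gamma \in H$ belongs to $H_2$ if and only if all of the following hold: (a) for every integer $i$ with $1 \leq i \leq l+1$ there are two integers $d_i, e_i$ greater than $1$ with $d_i \mid (q+1)$ and $e_i \mid (q-1)$ such that $|\theta^i(\gamma)| = d_i e_i$; (b) $|\theta^{l+2}(\gamma)|$ divides $q+1$; (c) $|\theta^i(\gamma)|$ divides $q-1$ for all integers $i \geq l+3$. (3) $\gamma \in H$ belongs to $H_3$ if and only if for every positive integer $i$ there are two integers $d_i, e_i$ greater than $1$ with $d_i \mid (q+1)$ and $e_i \mid (q-1)$ such that $|\theta^i(\gamma)| = d_i e_i$. Then $H = H_1 \cup H_2 \cup H_3$, and the pairwise intersections of $H_1$, $H_2$, $H_3$ are empty.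
   Context: For a finite field $F$ of characteristic $2$, the map $\theta$ on the projective line $\mathbf{P}^1(F) = F \cup \{\infty\}$ is defined by $\theta(0) = \theta(\infty) = \infty$ and $\theta(x) = x + x^{-1}$ for $x \in F \setminus \{0\}$ (compatibly with field extensions). $\theta^i$ denotes the $i$-fold composition of $\theta$ with itself. For a nonzero field element $x$, $|x|$ denotes its multiplicative order; by convention $|0| = 1$ and $|\infty| = 1$. *)

(* Defs.v *)
From HB Require Import structures.
From mathcomp Require Import all_boot all_fingroup all_algebra.
From mathcomp Require Import all_solvable.
From mathcomp Require Import boolp classical_sets.

Set Implicit Arguments.
Unset Strict Implicit.
Unset Printing Implicit Defensive.

Import GRing.Theory.
Local Open Scope classical_set_scope.
Local Open Scope nat_scope.

(* The projective line over F is [option F], with [None] as the point at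
   infinity. *)
Definition theta (F : finFieldType) (x : option F) : option F :=
  if x is Some y then if y == 0%R then None else Some (y + y^-1)%R else None.

(* [insub y] is the group element of {unit F} with value y when y is nonzero,
   and [None] when y = 0; thus |0| = |oo| = 1. *)
Definition pord (F : finFieldType) (x : option F) : nat :=
  if x is Some y then
    if (insub y : option {unit F}) is Some u then #[u]%g else 1
  else 1.

Definition theta_ord (F : finFieldType) (i : nat) (g : {unit F}) : nat :=
  pord (iter i (@theta F) (Some (val g))).

Definition mixed_order (q k : nat) : Prop :=
  exists d e : nat,
    [/\ 1 < d, 1 < e, d %| q + 1, e %| q - 1 & k = d * e].

Definition setH (F : finFieldType) (C : {group {unit F}}) : set {unit F} :=
  [set g | g \in C /\ g <> 1%g].

Definition setH1 (F : finFieldType) (C : {group {unit F}}) (q : nat) :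
    set {unit F} :=
  [set g | setH C g /\
    (theta_ord 1 g %| q + 1 /\ forall i, 2 <= i -> theta_ord i g %| q - 1)].

Definition setH2 (F : finFieldType) (C : {group {unit F}}) (l q : nat) :
    set {unit F} :=
  [set g | setH C g /\
    [/\ forall i, 1 <= i <= l + 1 -> mixed_order q (theta_ord i g),
        theta_ord (l + 2) g %| q + 1
      & forall i, l + 3 <= i -> theta_ord i g %| q - 1]].

Definition setH3 (F : finFieldType) (C : {group {unit F}}) (q : nat) :
    set {unit F} :=
  [set g | setH C g /\
    forall i, 0 < i -> mixed_order q (theta_ord i g)].

(* Main.v *)
Require Import Defs.
From HB Require Import structures.
From mathcomp Require Import all_boot all_fingroup all_algebra.
From mathcomp Require Import all_solvable all_field.
From mathcomp Require Import ring.
From mathcomp Require Import boolp classical_sets.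

Set Implicit Arguments.
Unset Strict Implicit.
Unset Printing Implicit Defensive.

Import GRing.Theory.

Local Open Scope ring_scope.

(* Let Y_i be the iterates of gamma and s the q-Frobenius. As s^2 inverts gamma,
   Y_1 is in F_{q^2} but not in F_q, and Y_(i+1) is in F_q exactly when Y_i is
   in F_q or s(Y_i) = 1/Y_i. So the only question is when the orbit enters F_q;
   suppose it does so at Y_(k+1). On the curve y^2 + xy = x^3 + 1 the map theta
   is the action on abscissas of the Verschiebung V, the dual of the 2-Frobenius.
   Hence if P is a point above gamma, the abscissa c of one of the points
   s(P) - P, s(P) + P satisfies theta^k(c) = 0 for this k. No group law is needed:
   c is given in terms of the partial trace of Y_1 by an explicit formula which
   commutes with theta, and the same formula yields s(c) = 1/c. By induction
   on k >= 2, every c with theta^k(c) = 0 satisfies c^(2^(2^(k-2))) = 1/c.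
   Comparing with c^(2^n) = 1/c, where n = 2^l m with m odd, gives k = l + 2. *)

Section CharTwo.

Variable F : fieldType.
Hypothesis char2 : 2 \in [pchar F].

Implicit Types (a b c u v x y z : F) (i j k n : nat).

(** * Arithmetic and Frobenius powers in characteristic 2 *)

Lemma addxx x : x + x = 0.
Proof. exact: addrr_pchar2. Qed.

Lemma oppx x : - x = x.
Proof. exact: oppr_pchar2. Qed.

Lemma addxK x y : x + y + y = x.
Proof. by rewrite -addrA addxx addr0. Qed.

Lemma addx_eq0 x y : (x + y == 0) = (x == y).
Proof. by rewrite -{1}[y]oppx subr_eq0. Qed.

Lemma sqrD2 x y : (x + y) ^+ 2 = x ^+ 2 + y ^+ 2.
Proof. by rewrite exprDn_pchar // pnatE. Qed.

Lemma frobD n x y : (x + y) ^+ (2 ^ n) = x ^+ (2 ^ n) + y ^+ (2 ^ n).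
Proof. by rewrite exprDn_pchar // pnatX pnatE ?char2. Qed.

Lemma frob_inj n : injective (fun x => x ^+ (2 ^ n)).
Proof.
move=> x y /eqP; rewrite -addx_eq0 -frobD expf_eq0 addx_eq0.
by case/andP=> _ /eqP.
Qed.

Lemma frob_sum n (I : finType) (f : I -> F) :
  (\sum_i f i) ^+ (2 ^ n) = \sum_i f i ^+ (2 ^ n).
Proof.
apply: (big_morph (fun x => x ^+ (2 ^ n))) => [x y|]; first exact: frobD.
by rewrite expr0n expn_eq0.
Qed.

(** * Partial traces *)

Definition ptr n x : F := \sum_(j < n) x ^+ (2 ^ j).

Lemma ptrD n x y : ptr n (x + y) = ptr n x + ptr n y.
Proof. by rewrite -big_split; apply: eq_bigr => j _; rewrite frobD. Qed.

Lemma ptr_frob n i x : ptr n (x ^+ (2 ^ i)) = ptr n x ^+ (2 ^ i).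
Proof. by rewrite frob_sum; apply: eq_bigr => j _; rewrite exprAC. Qed.

(** The sum telescopes, since signs disappear in characteristic 2. *)
Lemma ptr_artin_schreier n x : ptr n (x ^+ 2 + x) = x ^+ (2 ^ n) + x.
Proof.
elim: n => [|n IHn]; first by rewrite /ptr big_ord0 expn0 expr1 addxx.
rewrite /ptr big_ord_recr /= -/(ptr n _) IHn frobD -exprM -expnS.
by rewrite addrC addrA addxK.
Qed.

Lemma ptr_addn n k x : ptr (n + k) x = ptr n x + ptr k x ^+ (2 ^ n).
Proof.
rewrite /ptr big_split_ord frob_sum /=; congr (_ + _).
by apply: eq_bigr => j _; rewrite -exprM -expnD addnC.
Qed.

(** * The map [x + 1/x] *)

(* Since [0^-1 = 0], here [0] is a fixed point and stands for both [0] and the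
   point at infinity. *)
Definition th x : F := x + x^-1.

Lemma th0 : th 0 = 0.
Proof. by rewrite /th invr0 addr0. Qed.

Lemma iter_th0 i : iter i th 0 = 0.
Proof. by elim: i => //= i ->; rewrite th0. Qed.

Lemma thV x : th x^-1 = th x.
Proof. by rewrite /th invrK addrC. Qed.

Lemma thE x : x != 0 -> th x = (x + 1) ^+ 2 / x.
Proof. by move=> x0; rewrite sqrD2 /th; field. Qed.

Lemma th_eq0 x : x != 0 -> (th x == 0) = (x == 1).
Proof.
move=> x0; rewrite thE // mulf_eq0 invr_eq0 (negbTE x0) orbF.
by rewrite sqrf_eq0 addx_eq0.
Qed.

Lemma th_frob n x : th x ^+ (2 ^ n) = th (x ^+ (2 ^ n)).
Proof. by rewrite /th frobD exprVn. Qed.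

Lemma iter_th_frob n i x : iter i th x ^+ (2 ^ n) = iter i th (x ^+ (2 ^ n)).
Proof. by elim: i => //= i <-; rewrite th_frob. Qed.

Lemma thD a b : a != 0 -> b != 0 ->
  th a + th b = (a + b) * (a * b + 1) / (a * b).
Proof. by move=> a0 b0; rewrite /th; field; rewrite a0 b0. Qed.

Lemma th_eq a b : a != 0 -> b != 0 -> th a = th b -> a = b \/ b = a^-1.
Proof.
move=> a0 b0 /eqP; rewrite -addx_eq0 thD // !mulf_eq0 invr_eq0 mulf_eq0.
rewrite (negbTE a0) (negbTE b0) /= orbF !addx_eq0.
case/orP=> [/eqP|/eqP ab]; first by left.
by right; apply: (mulfI a0); rewrite ab divff.
Qed.

(** This Artin-Schreier form makes the partial trace of [(th x)^-1] telescope. *)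
Lemma invth x : x != 0 -> x != 1 -> (th x)^-1 = (x + 1)^-1 ^+ 2 + (x + 1)^-1.
Proof.
move=> x0; rewrite -addx_eq0 => x1; rewrite thE // -[X in _ = X + _]oppx.
by field; rewrite x0 x1.
Qed.

Lemma invD1V x : x != 0 -> x != 1 -> (x + 1)^-1 + (x^-1 + 1)^-1 = 1.
Proof.
move=> x0; rewrite -addx_eq0 => x1.
by field; rewrite x0 [1 + x]addrC x1.
Qed.

(** * Elements with [0] in their forward orbit *)

(** The trace clause carries the induction. With [t = th x], the roots of X^2 + tX + 1 are x and
    1/x, and the trace of t decides whether Frobenius exchanges them. The base case is a primitive
    cube root of unity. *)
Lemma th_torsion k x : iter k.+2 th x = 0 -> iter k.+1 th x != 0 ->
  x ^+ (2 ^ (2 ^ k)) = x^-1 /\ ptr (2 ^ k.+1) x = 1.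
Proof.
elim: k x => [|k IHk] x.
  move=> /= ttx0 tx0; have x0 : x != 0.
    by apply: contraNneq tx0 => ->; rewrite th0.
  have /eqP tx1 : th x == 1 by rewrite -th_eq0 //; apply/eqP.
  have xV : x^-1 = x + 1 by rewrite -tx1 /th addrA addxx add0r.
  have x2 : x ^+ 2 = x + 1.
    have := divff x0; rewrite xV mulrDr mulr1 -expr2 => <-.
    by rewrite addrCA addxx addr0.
  split; first by rewrite expn0 expn1 x2.
  by rewrite /ptr expn1 big_ord_recl big_ord1 /= x2 addrA addxx add0r.
rewrite iterSr => ttx; rewrite iterSr => tx0.
have [] := IHk (th x) ttx tx0; set t := th x; set M := (2 ^ k.+1)%N => tQ trt.
have t0 : t != 0.
  by apply: contraNneq tx0; rewrite -/t => ->; rewrite iter_th0.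
have x0 : x != 0 by apply: contraNneq t0; rewrite /t => ->; rewrite th0.
have tM : t ^+ (2 ^ M) = t.
  by rewrite /M expnS mul2n -addnn expnD exprM tQ exprVn tQ invrK.
have xx : x ^+ 2 + t * x = 1.
  by rewrite /t /th mulrDl mulVf // -expr2 addrA addxx add0r.
(* [z = x / t] solves the Artin-Schreier equation [z^2 + z = 1 / t^2]. *)
pose z := x / t.
have zz : z ^+ 2 + z = t^-1 ^+ 2.
  by rewrite -[RHS]mul1r -xx /z; field.
have zM : z ^+ (2 ^ M) = z + 1.
  (* As 1/t is a conjugate of t, the partial trace of 1/t^2 is also 1. *)
  have := ptr_artin_schreier M z.
  rewrite zz (ptr_frob M 1) -tQ ptr_frob trt !expr1n => ->.
  by rewrite addrC addxK.
have xE : x = t * z by rewrite /z mulrC divfK.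
have xM : x ^+ (2 ^ M) = x^-1.
  rewrite {1}xE exprMn tM zM mulrDr -xE mulr1.
  by rewrite /t /th addrA addxx add0r.
split; first exact: xM.
(* The two halves of the trace of x are the traces of x and 1/x, which add up to that of t. *)
rewrite expnS -/M mul2n -addnn ptr_addn -ptr_frob xM -ptrD.
exact: trt.
Qed.

(** If a Frobenius power inverts x, its odd iterates invert x and its even iterates fix x. Were k
    and l different, a common iterate would do both. *)
Lemma torsion_valuation k l m x : odd m ->
  iter k.+2 th x = 0 -> iter k.+1 th x != 0 ->
  x ^+ (2 ^ (2 ^ l * m)) = x^-1 -> k = l.
Proof.
move=> om tx0 tx1 xq; have [xN _] := th_torsion tx0 tx1.
have x0 : x != 0.
  by apply: contraNneq tx1 => ->; rewrite iter_th0.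
have xVx : x^-1 <> x.
  by move=> xV; move/eqP: tx1; case; rewrite iterSr {2}/th xV addxx iter_th0.
have alternate n j : x ^+ (2 ^ n) = x^-1 ->
    x ^+ (2 ^ (n * j)) = if odd j then x^-1 else x.
  move=> xn; elim: j => [|j IHj]; first by rewrite muln0 expr1.
  rewrite mulnS addnC expnD exprM IHj /=.
  by case: (odd j); rewrite ?exprVn xn ?invrK.
have [kl|lk|//] := ltngtP k l.
  case: xVx; rewrite -xq -(subnKC (ltnW kl)) expnD -mulnA alternate //.
  by rewrite oddM oddX subn_eq0 leqNgt kl.
case: xVx; have := alternate _ m xN; rewrite om => <-.
rewrite -(subnKC (ltnW lk)) expnD -mulnA [(_ ^ (k - l) * _)%N]mulnC mulnA.
by rewrite alternate // oddX subn_eq0 leqNgt lk.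
Qed.

(** * The difference of a point and its conjugate *)

(* If [a], [b] are the abscissas of points [A], [B] of the curve
   [y^2 + xy = x^3 + 1], then [dif a b v] is the abscissa of [A - B] or [A + B],
   depending on the choice of the root [v] of [v^2 + v = th a + th b]. *)
Definition dif a b v := a * b * v ^+ 2 / (a + b) ^+ 2.

(** Translation by the point of order 2 inverts abscissas, so the right-hand side is
    [dif a b^-1 (v + 1)]. *)
Lemma difV a b v : a != 0 -> b != 0 -> a != b -> a * b != 1 ->
  v ^+ 2 + v = th a + th b ->
  (dif a b v)^-1 = a * b * (v + 1) ^+ 2 / (a * b + 1) ^+ 2.
Proof.
move=> a0 b0; rewrite -addx_eq0 => ab; rewrite -addx_eq0 => ab1.
rewrite thD // => vE.
have v0 : v * (v + 1) = (a + b) * (a * b + 1) / (a * b) by rewrite -vE; ring.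
have vn0 : v != 0.
  apply: contraNneq ab1 => vz; move/eqP: v0; rewrite vz mul0r eq_sym.
  by rewrite !mulf_eq0 invr_eq0 mulf_eq0 (negbTE a0) (negbTE b0) (negbTE ab) /= orbF.
have -> : v + 1 = (a + b) * (a * b + 1) / (a * b) / v.
  by rewrite -v0 [v * _]mulrC mulfK.
by rewrite /dif; field; rewrite a0 b0 ab ab1 vn0.
Qed.

(** This expresses that V is additive. Over a common denominator, [dif a b v] and its inverse add up
    to a sum of two squares, which is again a square in characteristic 2. *)
Lemma th_dif a b v : a != 0 -> b != 0 -> a != 1 -> b != 1 ->
  a != b -> a * b != 1 -> v ^+ 2 + v = th a + th b ->
  th (dif a b v) = dif (th a) (th b) (v + ((a + 1)^-1 + (b + 1)^-1)).
Proof.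
move=> a0 b0 a1 b1 ab ab1 vE; rewrite {1}/th difV //.
move: a1 b1 ab ab1.
rewrite -[a == 1]addx_eq0 -[b == 1]addx_eq0.
rewrite -[a == b]addx_eq0 -[_ * _ == 1]addx_eq0.
move=> a1 b1 ab ab1; rewrite /dif thD // !thE //.
have -> : (a + 1)^-1 + (b + 1)^-1 = (a + b) / ((a + 1) * (b + 1)).
  by rewrite -[in RHS](addxK (a + b) 1); field; rewrite a1 b1.
have sq : (v * (a * b + 1)) ^+ 2 + ((v + 1) * (a + b)) ^+ 2
    = (v * ((a + 1) * (b + 1)) + (a + b)) ^+ 2.
  by rewrite -sqrD2; congr (_ ^+ 2); ring.
transitivity (a * b * ((v * (a * b + 1)) ^+ 2 + ((v + 1) * (a + b)) ^+ 2)
    / ((a + b) * (a * b + 1)) ^+ 2).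
  by rewrite /dif; field; rewrite ab ab1.
by rewrite sq; field; rewrite a0 b0 a1 b1 ab ab1.
Qed.

(** The pair Y_i, s(Y_i) is followed along the orbit with roots [v i] compatible with [th_dif];
    [c i] first vanishes with [v i], at i = k+1. *)
Lemma conj_dif_torsion n k g : g != 0 -> g ^+ (2 ^ n) ^+ (2 ^ n) = g^-1 ->
  (forall i, (i <= k.+1)%N -> iter i th g ^+ (2 ^ n) != iter i th g) ->
  iter k.+2 th g ^+ (2 ^ n) = iter k.+2 th g ->
  exists c, [/\ iter k.+1 th c = 0, iter k th c != 0 & c ^+ (2 ^ n) = c^-1].
Proof.
move=> g0 gss nfix fixk.
pose s x := x ^+ (2 ^ n); pose Y i := iter i th g.
have {}gss : s (s g) = g^-1 by [].
have sD x y : s (x + y) = s x + s y by apply: frobD.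
have sV x : s x^-1 = (s x)^-1 by apply: exprVn.
have s1 : s 1 = 1 by apply: expr1n.
have sM x y : s (x * y) = s x * s y by apply: exprMn.
have sX x i : s (x ^+ i) = s x ^+ i by apply: exprAC.
have sth x : s (th x) = th (s x) by apply: th_frob.
have sinj : injective s by apply: frob_inj.
have s0 : s 0 = 0 by rewrite /s expr0n expn_eq0.
have YS i : Y i.+1 = th (Y i) by [].
have Yss i : s (s (Y i.+1)) = Y i.+1.
  have -> : s (s (Y i.+1)) = iter i.+1 th (s (s g)) by rewrite /s !iter_th_frob.
  by rewrite gss /Y !iterSr thV.
have Yn0 i : (i <= k.+1)%N -> Y i != 0.
  by move=> /nfix; apply: contraNneq; rewrite -/(Y i) => ->; rewrite -/(s _) s0.
have Yn1 i : (i <= k.+1)%N -> Y i != 1.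
  by move=> /nfix; apply: contraNneq; rewrite -/(Y i) => ->; rewrite -/(s _) s1.
have sYn0 i : (i <= k.+1)%N -> s (Y i) != 0.
  by move=> /Yn0; apply: contraNneq => sY; apply/eqP/sinj; rewrite sY s0.
have sYn1 i : (i <= k.+1)%N -> s (Y i) != 1.
  by move=> /Yn1; apply: contraNneq => sY; apply/eqP/sinj; rewrite sY s1.
have YsY i : (i <= k.+1)%N -> Y i != s (Y i).
  by move=> /nfix; rewrite eq_sym.
have YsY1 i : (i < k.+1)%N -> Y i * s (Y i) != 1.
  move=> ik; apply: contraNneq (nfix _ ik) => Y1.
  apply/eqP; rewrite -/(s _) -/(Y _) YS sth -[th (Y i)]thV; congr th.
  by apply: (mulfI (Yn0 _ (ltnW ik))); rewrite Y1 divff // Yn0 // ltnW.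
have ptr2 x : ptr n x ^+ 2 + ptr n x = x + s x.
  by rewrite -(ptr_frob n 1) -ptrD ptr_artin_schreier addrC.
(* Since Y_(k+2) is in F_q, e is 0 or 1; adding it keeps the Artin-Schreier equations and makes
   [v k.+1] vanish. *)
pose e := ptr n (Y k.+2).
have e2 : e ^+ 2 = e by apply/eqP; rewrite -addx_eq0 ptr2 addx_eq0 eq_sym; apply/eqP/fixk.
pose v i := ptr n (Y i.+1) + e.
have vk : v k.+1 = 0 by apply: addxx.
have vE i : v i ^+ 2 + v i = th (Y i) + th (s (Y i)).
  by rewrite -sth -ptr2 /v sqrD2 e2 addrACA addxx addr0.
pose w i := (Y i + 1)^-1.
have sw i : s (w i) = (s (Y i) + 1)^-1 by rewrite /w sV sD s1.
have ssw i : s (s (w i)) = (s (s (Y i)) + 1)^-1 by rewrite sw sV sD s1.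
have vS i : (i <= k.+1)%N -> v i.+1 = v i + (w i + s (w i)).
  move=> ik; rewrite /v !YS {1}/th ptrD invth ?Yn0 ?Yn1 //.
  by rewrite ptr_artin_schreier [_ ^+ _ + _]addrC addrAC.
have svS i : (i <= k.+1)%N ->
    s (v i.+1) + v i.+1 = s (v i) + v i + (w i + s (s (w i))).
  move=> ik; rewrite vS // !sD.
  by rewrite addrACA; congr (_ + _); rewrite addrC addrA addxK.
(* From index 1 on, s^2 fixes Y_i, so s(v_i) + v_i is constant, and it is 0 at the end. *)
have svD i : (i <= k)%N -> s (v i.+1) + v i.+1 = s (v 1%N) + v 1%N.
  elim: i => // i IHi ik; rewrite svS 1?ltnW // ssw Yss addxx addr0.
  by rewrite IHi // ltnW.
have sv1 : s (v 1%N) + v 1%N = 0 by rewrite -(svD k) // vk s0 addr0.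
(* At index 0, s^2 inverts g instead, which contributes the extra 1. *)
have sv0 : s (v 0%N) = v 0%N + 1.
  have := svS 0%N isT; rewrite sv1 ssw gss invD1V ?(Yn1 0%N) //.
  by move/esym/eqP; rewrite -addrA addx_eq0 => /eqP.
pose c i := dif (Y i) (s (Y i)) (v i).
have cS i : (i < k.+1)%N -> c i.+1 = th (c i).
  move=> ik; rewrite /c th_dif ?Yn0 ?sYn0 ?Yn1 ?sYn1 ?YsY ?YsY1 // 1?ltnW //.
  by rewrite vS 1?ltnW // sw YS sth.
have cE i : (i <= k.+1)%N -> iter i th (c 0%N) = c i.
  by elim: i => //= i IHi ik; rewrite IHi 1?ltnW // cS.
exists (c 0%N); split.
- by rewrite cE // /c /dif vk expr0n mulr0 mul0r.
- have vk0 : v k != 0.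
    apply: contraNneq (nfix k.+1 (leqnn _)) => vk0; have := vE k.
    by rewrite vk0 expr0n addr0 => /esym/eqP; rewrite addx_eq0 -sth eq_sym.
  rewrite cE // mulf_neq0 ?invr_eq0 ?expf_neq0 ?addx_eq0 ?YsY //.
  by rewrite !mulf_neq0 ?expf_neq0 ?Yn0 ?sYn0.
(* Applying s sends g, s(g), v_0 to s(g), 1/g, v_0 + 1, which gives the formula of [difV]. *)
- rewrite -/(s _) difV ?Yn0 ?sYn0 ?YsY ?YsY1 //.
  rewrite /dif sM sV !sX (sD (Y 0%N)) !sM sX sv0 -/(s _) /Y /= gss.
  have := YsY1 0%N isT; rewrite -addx_eq0 /Y /= => gsg.
  by field; rewrite g0 gsg.
Qed.

End CharTwo.

(** * Orders of points of the projective line *)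

Section ProjectiveOrder.

Variable F : finFieldType.
Implicit Types (x : F) (d q : nat).

(** Merging infinity with 0 is harmless, both having order 1 by convention. *)
Lemma theta_ordE i (g : {unit F}) :
  theta_ord i g = pord (Some (iter i (@th F) (val g))).
Proof.
rewrite /theta_ord; set x := val g.
suff [->//|[-> ->]] : iter i (@theta F) (Some x) = Some (iter i (@th F) x) \/
    iter i (@theta F) (Some x) = None /\ iter i (@th F) x = 0.
  by rewrite /pord insubF // unitr0.
elim: i => [|i [IHi|[IHi x0]]]; first by left.
  by rewrite /= IHi /=; case: eqP => [->|_]; [right; rewrite th0|left].
by right; rewrite /= IHi x0 th0.
Qed.

Lemma pord_dvdn x d : (pord (Some x) %| d)%N = (x == 0) || (x ^+ d == 1).
Proof.
rewrite /pord; case: insubP => [u xu ux|].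
  rewrite unitfE in xu.
  by rewrite order_dvdn -val_eqE FinRing.val_unitX ux (negbTE xu).
rewrite unitfE negbK => /eqP->.
by rewrite eqxx dvd1n.
Qed.

Lemma pord_dvdn_pred x q : (0 < q)%N -> (pord (Some x) %| q - 1)%N = (x ^+ q == x).
Proof.
move=> q0; rewrite pord_dvdn.
have -> : x ^+ q = x * x ^+ (q - 1) by rewrite -exprS -addn1 subnK.
have [->|x0] := eqVneq; first by rewrite mul0r eqxx.
by rewrite -[X in _ = (_ == X)]mulr1 (inj_eq (mulfI x0)).
Qed.

(** For even q, the numbers q+1 and q-1 are coprime, while e would divide both. *)
Lemma mixed_order_ndvdn q k : ~~ odd q -> mixed_order q k -> ~~ (k %| q + 1)%N.
Proof.
move=> eq [d [e [_ e1 _ em ->]]]; apply/negP => kq.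
have ep : (e %| q + 1)%N by apply: dvdn_trans kq; apply: dvdn_mull.
case: q eq em ep {kq} => [|q]; first by rewrite dvdn1 => _ _ /eqP ee; rewrite ee in e1.
rewrite subn1 /= negbK addn1 -addn2 => oq em; rewrite dvdn_addr // => e2.
have co : coprime q 2 by rewrite coprimen2.
have := dvdn_gcd e q 2; rewrite (eqP co) em e2 dvdn1 => /eqP ee.
by rewrite ee in e1.
Qed.

(** With d = gcd(k, q+1), the cofactor k/d is coprime to (q+1)/d, hence divides q-1. *)
Lemma mixed_orderI q k : (k %| q ^ 2 - 1)%N ->
  ~~ (k %| q + 1)%N -> ~~ (k %| q - 1)%N -> mixed_order q k.
Proof.
have -> : (q ^ 2 - 1 = (q + 1) * (q - 1))%N by rewrite -[in LHS](exp1n 2) subn_sqr mulnC.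
move=> kq np nm.
pose d := gcdn k (q + 1); have d0 : (0 < d)%N by rewrite gcdn_gt0 addn1 orbT.
have kE : k = (d * (k %/ d))%N by rewrite mulnC divnK // dvdn_gcdl.
have qE : (q + 1 = d * ((q + 1) %/ d))%N by rewrite mulnC divnK // dvdn_gcdr.
have co : coprime (k %/ d) ((q + 1) %/ d).
  by rewrite /coprime -(eqn_pmul2l d0) muln_gcdr -kE -qE muln1.
have eq : (k %/ d %| q - 1)%N.
  by rewrite -(Gauss_dvdr _ co) -(dvdn_pmul2l d0) -kE mulnA -qE.
exists d, (k %/ d)%N; split=> //; last exact: dvdn_gcdr.
  rewrite ltn_neqAle d0 andbT; apply: contraNneq nm => d1.
  by rewrite -d1 divn1 in eq.
case e: (k %/ d)%N eq => [|[|//]] eq.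
  by move: nm; rewrite {1}kE e muln0 eq.
by move: np; rewrite {1}kE e muln1 dvdn_gcdr.
Qed.

End ProjectiveOrder.

(** * The partition of H *)

Local Open Scope classical_set_scope.
Local Open Scope nat_scope.

Theorem theorem4p3 (l m n q : nat) (hm : odd m) (hn : n = 2 ^ l * m)
    (hq : q = 2 ^ n) (F : finFieldType) (hF : #|F| = q ^ 4)
    (C : {group {unit F}}) (hCcyc : cyclic C) (hC : #|C| = q ^ 2 + 1) :
  [/\ setH C = setH1 C q `|` setH2 C l q `|` setH3 C q,
      setH1 C q `&` setH2 C l q = set0,
      setH1 C q `&` setH3 C q = set0
    & setH2 C l q `&` setH3 C q = set0].
Proof.
have n0 : 0 < n by rewrite hn muln_gt0 expn_gt0 (odd_gt0 hm).
have eq : ~~ odd q by rewrite hq oddX negb_or negbK -lt0n n0.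
split; last 3 first.
(* Index 1 separates H_1 from H_2 and H_3; index l+2 separates H_2 from H_3. *)
- apply/seteqP; split=> // g [[_ [g1 _]] [_ [/(_ 1) mg _ _]]].
  by move: mg; rewrite addn1 => /(_ isT)/(mixed_order_ndvdn eq); rewrite g1.
- apply/seteqP; split=> // g [[_ [g1 _]] [_ /(_ 1 isT) mg]].
  by have := mixed_order_ndvdn eq mg; rewrite g1.
- apply/seteqP; split=> // g [[_ [_ g1 _]] [_ /(_ (l + 2))]].
  by rewrite addn2 => /(_ isT) /(mixed_order_ndvdn eq); rewrite addn2 in g1; rewrite g1.
apply/seteqP; split=> g; last by case=> [[]|] [].
move=> gH; have [gC g1] := gH.
have q0 : 0 < q by rewrite hq expn_gt0.
have char2 : 2%N \in [pchar F]%R.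
  by apply: (@card_finPcharP _ _ (n * 4)) => //; rewrite hF hq expnM.
pose x := val g; pose Y i := iter i (@th F) x.
pose fixed i := (Y i ^+ q == Y i)%R.
have ordE i : theta_ord i g = pord (Some (Y i)) by apply: theta_ordE.
have x0 : x != 0%R by rewrite -unitfE; apply: (valP g).
have xss : (x ^+ q ^+ q = x^-1)%R.
  apply: (mulfI x0); rewrite divff // -exprM -exprS.
  have := order_dvdG gC; rewrite hC order_dvdn -val_eqE FinRing.val_unitX.
  by rewrite addn1 mulnn => /eqP.
have xVx : (x^-1 != x)%R.
  apply/eqP => xV; apply: g1; apply: val_inj; apply/eqP.
  by rewrite -(th_eq0 char2 x0) /th xV (addxx char2).
have fixed_mono i j : i <= j -> fixed i -> fixed j.
  move=> /subnK <- fi; elim: (j - i) => // d /eqP IHd.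
  by rewrite /fixed addSn /= hq (th_frob char2) -hq IHd.
have Yn0 i : ~~ fixed i -> Y i != 0%R.
  by apply: contraNneq => Y0; rewrite /fixed Y0 expr0n eqn0Ngt q0.
have fixedS i : ~~ fixed i -> fixed i.+1 = (theta_ord i g %| q + 1).
  move=> nf; have Y0 := Yn0 i nf.
  rewrite ordE pord_dvdn (negbTE Y0) /= addn1 exprS /fixed /= hq (th_frob char2) -hq.
  apply/eqP/eqP => [/esym/(th_eq char2 Y0 (expf_neq0 q Y0))|YY].
    case=> [/esym/eqP|->]; last by rewrite divff.
    by rewrite -/(fixed i) (negbTE nf).
  by rewrite -[RHS]thV; congr th; apply: (mulfI Y0); rewrite YY divff.
have nfix0 : ~~ fixed 0.
  by apply: contraNN xVx => /eqP fx; rewrite -xss -[x]/(Y 0) !fx.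
have nfix1 : ~~ fixed 1.
  rewrite fixedS // ordE pord_dvdn (negbTE x0) addn1 exprS /=.
  apply: contraNN xVx => /eqP xq.
  have xV : (x ^+ q = x^-1)%R by apply: (mulfI x0); rewrite xq divff.
  by rewrite -{1}xss xV exprVn xV invrK.
have fixed_ord i : (theta_ord i g %| q - 1) = fixed i.
  by rewrite ordE pord_dvdn_pred.
(* For i >= 1, Y_i lies in F_{q^2}, so its order divides q^2 - 1. *)
have mixed i : 0 < i -> ~~ fixed i.+1 -> mixed_order q (theta_ord i g).
  case: i => // i _ nf.
  have nf' : ~~ fixed i.+1 by apply: contraNN nf; apply: fixed_mono.
  apply: mixed_orderI; last 2 first.
  - by rewrite -fixedS.
  - by rewrite fixed_ord.
  rewrite ordE pord_dvdn_pred ?expn_gt0 ?q0 // -mulnn exprM hq.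
  by rewrite /Y !(iter_th_frob char2) -hq xss !iterSr thV.
have [[N fN]|nofix] := pselect (exists N, fixed N); last first.
  right; split=> // i i0; apply: mixed => //.
  by apply/negP => fi; apply: nofix; exists i.+1.
left; case: (ex_minnP (ex_intro _ N fN)) => {fN}N fN Nmin.
have nfix i : i < N -> ~~ fixed i.
  by rewrite ltnNge; apply: contraNN; apply: Nmin.
(* The entry index N is at least 2; N = 2 gives H_1, and N = k+3 gives H_2 once k = l is known. *)
case: N fN Nmin nfix => [|[|[|k]]] fN _ nfix; first by rewrite fN in nfix0.
- by rewrite fN in nfix1.
- left; split=> //; split; first by rewrite -fixedS.
  by move=> i i2; rewrite fixed_ord; apply: fixed_mono fN.
right; split=> //.
have [|||c [c0 c1 cV]] := @conj_dif_torsion _ char2 n k.+1 x x0.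
- by rewrite -hq.
- by move=> i ik; rewrite -hq; apply: nfix.
- by rewrite -hq; apply/eqP.
have <- : k = l by apply: (torsion_valuation char2 hm c0 c1); rewrite -hn.
split.
- by move=> i /andP[i0 ik]; apply: mixed => //; apply: nfix; rewrite addn1 in ik.
- by rewrite addn2 -fixedS // nfix.
by move=> i; rewrite addn3 fixed_ord => /fixed_mono; apply.
Qed.
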